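(* Let $m$ and $k$ be positive integers and let $R$ be any ring. Let $a_1,\ldots,a_k$ be elements of $R$ and $I_1,\ldots,I_k$ ideals of $R$. Let $t\in\{1,\ldots,k\}$. If $\{a_s+I_s\}_{s=1}^k$ is an $m$-cover of $R$ with the coset $a_t+I_t$ irredundant, then the quotient ring $R/I_t$ is finite, $|R/I_t|\le 2^{k-m}$, and furthermore $k\ge m+f(|R/I_t|)$.
   Context: A finite system (repetitions allowed) $\{a_s+I_s\}_{s=1}^k$ of cosets is an $m$-cover of $R$ if every $x\in R$ satisfies $|\{1\le s\le k:\ x\in a_s+I_s\}|\ge m$. The coset $a_t+I_t$ is irredundant if the subsystem $\{a_s+I_s\}_{1\le s\le k,\ s\ne t}$ is not an $m$-cover of $R$. The Mycielski function $f:\{1,2,3,\ldots\}\to\{0,1,2,\ldots\}$ is given by $f(n)=\sum_{p\in P(n)}\operatorname{ord}_p(n)(p-1)$, where $P(n)$ is the set of prime divisors of $n$ and $\operatorname{ord}_p(n)$ is the largest nonnegative integer $\alpha$ with $p^\alpha\mid n$ (so $f(1)=0$). *)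

(* Defs.v *)
From HB Require Import structures.
From mathcomp Require Import all_boot all_order all_algebra.
From mathcomp Require Import finmap all_classical.

Set Implicit Arguments.
Unset Strict Implicit.
Unset Printing Implicit Defensive.

Import GRing.Theory.
Local Open Scope ring_scope.
Local Open Scope quotient_scope.

(* Two-sided ideals of a possibly noncommutative, possibly zero ring. Unlike
   the library's [idealr], the ideal may be the whole ring. *)
HB.mixin Record isTwoSidedIdeal (R : pzRingType) (S : R -> bool) := {
  ideal_mull_subproof : forall a, {in S, forall u, a * u \in S};
  ideal_mulr_subproof : forall a, {in S, forall u, u * a \in S}
}.

#[short(type="twoSidedIdeal")]
HB.structure Definition TwoSidedIdeal (R : pzRingType) :=
  {S of GRing.ZmodClosed R S & isTwoSidedIdeal R S}.

Lemma ideal_mull (R : pzRingType) (I : twoSidedIdeal R) (a u : R) :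
  u \in I -> a * u \in I.
Proof. exact: ideal_mull_subproof. Qed.

Lemma ideal_mulr (R : pzRingType) (I : twoSidedIdeal R) (a u : R) :
  u \in I -> u * a \in I.
Proof. exact: ideal_mulr_subproof. Qed.

(* [Quotient.quot I] is the additive quotient group; the library gives it a ring
   structure for commutative nonzero [R] and proper ideals only, hence this
   alias, which carries the quotient ring in general. *)
Definition ringQuot (R : pzRingType) (I : twoSidedIdeal R) : Type :=
  Quotient.quot I.

Section RingQuot.
Variables (R : pzRingType) (I : twoSidedIdeal R).
Local Notation Q := (ringQuot I).

HB.instance Definition _ := GRing.Zmodule.copy Q (Quotient.quot I).
HB.instance Definition _ := EqQuotient.copy Q (Quotient.quot I).
HB.instance Definition _ :=
  @isZmodQuotient.Build R (Quotient.equiv I) 0 -%R +%R Q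
    (lock _) (@Quotient.pi_opp R I) (@Quotient.pi_add R I).

Definition ringQuot_one : Q := \pi_Q 1.
Definition ringQuot_mul := lift_op2 Q *%R.

Lemma ringQuot_pi_mul (x y : R) :
  \pi_Q (x * y) = ringQuot_mul (\pi_Q x) (\pi_Q y).
Proof.
have eqI (u v : R) : u - v \in I -> \pi_Q u = \pi_Q v.
  by rewrite Quotient.idealrBE => /eqP.
have reprI (u : R) : u - repr (\pi_Q u) \in I.
  by rewrite Quotient.idealrBE; apply/eqP; rewrite reprK.
unlock ringQuot_mul; apply: eqI.
set y' := repr (\pi_Q y); set x' := repr (\pi_Q x).
rewrite -[x * y](subrK (x * y')) -mulrBr -addrA -mulrBl rpredD //.
  exact: ideal_mull (reprI y).
exact: ideal_mulr (reprI x).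
Qed.

Lemma ringQuot_mulA : associative ringQuot_mul.
Proof.
move=> x y z; rewrite -[x]reprK -[y]reprK -[z]reprK.
by rewrite -!ringQuot_pi_mul mulrA.
Qed.

Lemma ringQuot_mul1 : left_id ringQuot_one ringQuot_mul.
Proof. by move=> x; rewrite -[x]reprK -ringQuot_pi_mul mul1r. Qed.

Lemma ringQuot_mulr1 : right_id ringQuot_one ringQuot_mul.
Proof. by move=> x; rewrite -[x]reprK -ringQuot_pi_mul mulr1. Qed.

Lemma ringQuot_mulDl : left_distributive ringQuot_mul +%R.
Proof.
move=> x y z; rewrite -[x]reprK -[y]reprK -[z]reprK.
by rewrite -pi_addr -!ringQuot_pi_mul -pi_addr mulrDl.
Qed.

Lemma ringQuot_mulDr : right_distributive ringQuot_mul +%R.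
Proof.
move=> x y z; rewrite -[x]reprK -[y]reprK -[z]reprK.
by rewrite -pi_addr -!ringQuot_pi_mul -pi_addr mulrDr.
Qed.

HB.instance Definition _ := GRing.Zmodule_isPzRing.Build Q
  ringQuot_mulA ringQuot_mul1 ringQuot_mulr1 ringQuot_mulDl ringQuot_mulDr.

End RingQuot.

Definition icoset (R : pzRingType) (a : R) (I : twoSidedIdeal R) : {pred R} :=
  [pred x | x - a \in I].

Lemma icosetP (R : pzRingType) (a : R) (I : twoSidedIdeal R) (x : R) :
  reflect (exists2 u, u \in I & x = a + u) (x \in icoset a I).
Proof.
apply: (iffP idP) => [xI|[u uI ->]]; last by rewrite inE addrC addKr.
by exists (x - a); rewrite // addrC subrK.
Qed.

(* The subsystem indexed by [S] is an [m]-cover; indexing keeps track of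
   repeated cosets. *)
Definition is_mcover (R : pzRingType) (k m : nat) (a : 'I_k -> R)
    (I : 'I_k -> twoSidedIdeal R) (S : {set 'I_k}) : Prop :=
  forall x : R, (m <= #|[set s in S | x \in icoset (a s) (I s)]|)%N.

Definition irredundant (R : pzRingType) (k m : nat) (a : 'I_k -> R)
    (I : 'I_k -> twoSidedIdeal R) (t : 'I_k) : Prop :=
  ~ is_mcover m a I [set~ t]%SET.

Definition mycielski (n : nat) : nat :=
  (\sum_(p <- primes n) logn p n * (p - 1))%N.

(* Main.v *)
Require Import Defs.
From mathcomp Require Import all_boot all_order all_algebra all_field.
From mathcomp Require Import finmap all_classical.

(** The proof takes place in the additive group of [R]. Choose a point [x0] that
    fewer than [m] of the cosets other than the [t]-th contain. The cosets that
    miss [x0] are at most [k - m] in number and, translated by [- x0], they miss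
    [0] and cover everything outside [I t] ([irredundant_reduction]). So let [b_j + K_j], for
    [j] in [J], be cosets of subgroups of an abelian group [A] that miss [0] and
    cover the complement of a subgroup [H] of index [n]; the claim is that the
    Mycielski function of [n] is at most [#|J|].

    As [b_j] is not in [K_j], some character [chi_j] of [A] with values in the
    roots of unity is trivial on [K_j] and takes a value [z_j != 1] at [b_j],
    hence on the whole coset ([pchar_separates]). The product [h] of the
    functions [chi_j - z_j] therefore vanishes outside [H]. Expanded, it is a
    combination of characters with coefficients in the algebraic integers, and
    orthogonality of characters shows that [n] divides [h 0], the product of the
    [1 - z_j], among algebraic integers ([dvdA_sum_characters]).

    For a prime [p], the number [1 - z_j] has [p]-adic valuation at most
    [1 / (p - 1)] if the order of [z_j] is a power of [p], and [0] otherwise. So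
    at least [logn p n * (p - 1)] of the [z_j] have order a power of [p], and
    summing over [p] gives the bound ([mycielski_le_card]). The bound
    [2 ^ (k - m)] follows because [n <= 2 ^ mycielski n].

    Finiteness of the index is obtained along the way. The argument is run on the
    subgroup generated by finitely many elements, where the characters take
    finitely many values, so that it takes place in a finite group of coordinates
    ([mycielski_bound]); it bounds the number of classes modulo [H] that these
    elements meet independently of their choice. *)

Set Implicit Arguments.
Unset Strict Implicit.
Unset Printing Implicit Defensive.

Import GRing.Theory Num.Theory.
Local Open Scope ring_scope.

(** * Divisibility of [1 - z] for roots of unity *)

Definition finite_order (z : algC) : Prop := exists2 d, (0 < d)%N & z ^+ d = 1.

Lemma finite_order1 : finite_order 1.
Proof. by exists 1%N; rewrite ?expr1. Qed.

Lemma finite_orderM z w :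
  finite_order z -> finite_order w -> finite_order (z * w).
Proof.
move=> [c c0 zc] [d d0 wd]; exists (c * d)%N; rewrite ?muln_gt0 ?c0 //.
by rewrite exprMn exprM zc expr1n mul1r mulnC exprM wd expr1n.
Qed.

Lemma finite_orderXz z (n : int) : finite_order z -> finite_order (z ^ n).
Proof.
move=> [d d0 zd]; exists d => //.
by rewrite exprnP exprzAC -exprnP zd exp1rz.
Qed.

Lemma finite_order_neq0 z : finite_order z -> z != 0.
Proof.
case=> d d0 /eqP; apply: contraTneq => ->.
by rewrite expr0n gtn_eqF // eq_sym oner_neq0.
Qed.

Lemma dvdAP (e x : algC) :
  reflect (exists2 y, y \in Aint & x = e * y) (e %| x)%A.
Proof.
apply: (iffP idP) => [|[y yA ->]]; last by rewrite -eqAmod0 eqAmodMr0.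
rewrite unfold_in; case: eqP => [-> /eqP->|/eqP e0 xe].
  by exists 0; rewrite ?Aint0 ?mul0r.
by exists (x / e); rewrite // mulrC divfK.
Qed.

Lemma dvdA_trans (e f x : algC) : (e %| f)%A -> (f %| x)%A -> (e %| x)%A.
Proof.
move=> /dvdAP[y yA ->] /dvdAP[z zA ->]; apply/dvdAP.
by exists (y * z); rewrite ?rpredM ?mulrA.
Qed.

Lemma dvdA_prod (I : Type) (r : seq I) (P : pred I) (F G : I -> algC) :
  (forall i, P i -> (F i %| G i)%A) ->
  (\prod_(i <- r | P i) F i %| \prod_(i <- r | P i) G i)%A.
Proof.
move=> FG; apply: (big_rec2 (fun x y : algC => (x %| y)%A)).
  by apply/dvdAP; exists 1; rewrite ?rpred1 ?mulr1.
move=> i x y /FG /dvdAP[u uA ->] /dvdAP[v vA ->]; apply/dvdAP.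
by exists (u * v); rewrite ?rpredM // mulrACA.
Qed.

Lemma dvdA_nat (m n : nat) : (m%:R %| (n%:R : algC))%A = (m %| n)%N.
Proof. by rewrite -eqAmod0 eqAmod0_nat. Qed.

(** The factorisation of [1 - z ^+ i] by [1 - z] transfers divisibility from a
    power of a root of unity, whose order can be chosen, to the root itself. *)
Lemma dvdA_1subX (z : algC) i : z \in Aint -> (1 - z %| 1 - z ^+ i)%A.
Proof.
move=> zA; apply/dvdAP; exists (\sum_(j < i) z ^+ j).
  by apply: rpred_sum => j _; rewrite rpredX.
by rewrite -opprB subrX1 -mulNr opprB.
Qed.

(** This is ['X^n - 1] divided by ['X - 1], evaluated at [1] in two ways. *)
Lemma prod_1sub_prim_root n (z : algC) :
  n.+1.-primitive_root z -> \prod_(i < n) (1 - z ^+ i.+1) = n.+1%:R.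
Proof.
move=> zP; have := factor_Xn_sub_1 zP.
rewrite big_nat_recl // expr0 subrX1 -polyC1.
move=> /(mulfI (negbT (polyXsubC_eq0 _))) /(congr1 (fun p : {poly algC} => p.[1])).
rewrite big_mkord horner_prod horner_sum.
under eq_bigr do rewrite hornerXsubC.
move=> ->; rewrite (eq_bigr (fun=> 1)) => [|i _].
  by rewrite sumr_const card_ord.
by rewrite hornerXn expr1n.
Qed.

Lemma dvdA_1sub_prim_root n (z : algC) :
  (1 < n)%N -> n.-primitive_root z -> (1 - z %| n%:R)%A.
Proof.
case: n => [|[|n]] // _ zP; rewrite -(prod_1sub_prim_root zP) big_ord_recl expr1.
apply/dvdAP; exists (\prod_(i < n) (1 - z ^+ (lift ord0 i).+1)) => //.
by apply: rpred_prod => i _; rewrite rpredB ?rpred1 ?rpredX ?(Aint_prim_root zP).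
Qed.

(** The [p]-adic valuation of [1 - z] is at most [1 / (p - 1)]. Some power [w] of
    [z] has order [p]; then [p] is the product of the [p - 1] factors
    [1 - w ^+ i], each of which is a multiple of [1 - z]. *)
Lemma dvdA_1sub_pnat_root p n (z : algC) :
  prime p -> (1 < n)%N -> p.-nat n -> n.-primitive_root z ->
  ((1 - z) ^+ p.-1 %| p%:R)%A.
Proof.
move=> p_pr n_gt1 /p_natP[[|a] def_n] zP; first by rewrite def_n in n_gt1.
have zA := Aint_prim_root zP.
have wP : p.-primitive_root (z ^+ (p ^ a)).
  have := exp_prim_root zP (p ^ a).
  by rewrite def_n expnS gcdnMl mulnK // expn_gt0 prime_gt0.
case: p p_pr wP {def_n} => // p p_pr wP.
have -> : (1 - z) ^+ p.+1.-1 = \prod_(i < p) (1 - z).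
  by rewrite prodr_const card_ord.
rewrite -(prod_1sub_prim_root wP).
by apply: dvdA_prod => i _; rewrite -exprM dvdA_1subX.
Qed.

(** When the order of [z] is not a power of [p], the power of [z] of order
    [n`_p^'] is still different from [1], so [1 - z] divides an integer prime to
    [p]: its [p]-adic valuation is [0]. *)
Lemma dvdA_1sub_not_pnat_root p n (z : algC) :
  ~~ p.-nat n -> n.-primitive_root z ->
  (1 - z %| (n`_p^')%:R)%A.
Proof.
move=> pn zP; have n0 := prim_order_gt0 zP.
have wP : (n`_p^')%N.-primitive_root (z ^+ n`_p).
  have := exp_prim_root zP n`_p%N; rewrite (gcdn_idPl (dvdn_part _ _)).
  by rewrite -{1}(partnC p n0) mulKn // part_gt0.
apply: dvdA_trans (dvdA_1subX _ (Aint_prim_root zP)) (dvdA_1sub_prim_root _ wP).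
by rewrite ltn_neqAle eq_sym part_gt0 andbT partn_eq1 ?pnatNK.
Qed.

(** Comparison of [p]-adic valuations. Raising the divisibility to the power
    [p - 1] and bounding each [(1 - z j) ^+ (p - 1)] by [p] or by an integer prime
    to [p] leaves a divisibility between integers. *)
Lemma logn_le_card_pnat_roots (J : finType) (z : J -> algC) (o : J -> nat)
    (n p : nat) :
  prime p -> (forall j, 1 < o j)%N ->
  (forall j, (o j).-primitive_root (z j)) ->
  (n%:R %| \prod_j (1 - z j))%A ->
  (logn p n * (p - 1) <= #|[pred j | p.-nat (o j)]|)%N.
Proof.
move=> p_pr o1 zP; rewrite subn1.
pose g j := if p.-nat (o j) then p else ((o j)`_p^' ^ p.-1)%N.
move=> /dvdAP[y yA n_dvd].
have : ((n ^ p.-1)%:R %| ((\prod_j g j)%:R : algC))%A.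
  apply: (@dvdA_trans _ (\prod_j (1 - z j) ^+ p.-1)).
    rewrite prodrXl n_dvd natrX exprMn; apply/dvdAP.
    by exists (y ^+ p.-1); rewrite ?rpredX.
  rewrite natr_prod; apply: dvdA_prod => j _; rewrite /g.
  case: ifPn => [pn|pn]; first exact: dvdA_1sub_pnat_root (zP j).
  have /dvdAP[x xA def_M] := dvdA_1sub_not_pnat_root pn (zP j).
  by rewrite natrX def_M exprMn; apply/dvdAP; exists (x ^+ p.-1);
     rewrite ?rpredX.
rewrite dvdA_nat.
rewrite (bigID (fun j => p.-nat (o j))) /= => n_dvdn.
have {}n_dvdn := dvdn_trans (dvdn_exp2r p.-1 (pfactor_dvdnn p n)) n_dvdn.
rewrite -expnM Gauss_dvdl in n_dvdn; last first.
  apply: coprimeXl; apply: (big_ind (coprime p)); first exact: coprimen1.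
    by move=> a b pa pb; rewrite coprimeMr pa.
  move=> j pn; rewrite /g (negPf pn); apply: coprimeXr.
  exact: (pnat_coprime (pnat_id p_pr) (part_pnat _ _)).
rewrite (eq_bigr (fun=> p)) in n_dvdn; last by move=> j pn; rewrite /g pn.
by rewrite prod_nat_const dvdn_Pexp2l ?prime_gt1 // in n_dvdn.
Qed.

(** A number greater than [1] is a power of at most one prime, so the sets of
    factors that account for the various primes dividing [n] are disjoint. *)
Lemma mycielski_le_card (J : finType) (z : J -> algC) (n : nat) :
  (forall j, z j != 1) -> (forall j, finite_order (z j)) ->
  (n%:R %| \prod_j (1 - z j))%A -> (mycielski n <= #|J|)%N.
Proof.
move=> z1 zU n_dvd.
have /choice[o oP] (j : J) : exists d, (1 < d)%N && d.-primitive_root (z j).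
  have [d d0 zd] := zU j; have [m mP _] := prim_order_exists d0 zd.
  exists m; rewrite mP andbT ltn_neqAle (prim_order_gt0 mP) andbT.
  by apply: contraNneq (z1 j) => m1; rewrite -(prim_expr_order mP) -m1.
have [o1 zP] : (forall j, 1 < o j)%N /\ (forall j, (o j).-primitive_root (z j)).
  by split=> j; have /andP[] := oP j.
apply: leq_trans (_ : \sum_(p <- primes n) #|[pred j | p.-nat (o j)]| <= _)%N.
  rewrite /mycielski big_seq [leqRHS]big_seq; apply: leq_sum => p.
  rewrite mem_primes => /and3P[p_pr _ _].
  exact: logn_le_card_pnat_roots zP n_dvd.
under eq_bigr do rewrite -sum1_card big_mkcond.
rewrite exchange_big -sum1_card leq_sum // => j _ /=.
rewrite -big_mkcond sum1_count.
(* The only prime of which [o j] can be a power is [pdiv (o j)]. *)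
apply: leq_trans (_ : count_mem (pdiv (o j)) (primes n) <= _)%N; last first.
  by rewrite count_uniq_mem ?primes_uniq // leq_b1.
apply: sub_count => p pn.
have := @pnatPpi p (o j) (pdiv (o j)) pn.
by rewrite pi_pdiv o1 !inE eq_sym; apply.
Qed.

(** Factor by factor, this is [p <= 2 ^ (p - 1)]. *)
Lemma leq_exp2_mycielski n : (n <= 2 ^ mycielski n)%N.
Proof.
have [->|n0] := posnP n; first by [].
rewrite {1}(prod_prime_decomp n0) prime_decompE big_map /mycielski expn_sum.
rewrite big_seq [leqRHS]big_seq; apply: leq_prod => p p_n /=.
have p_pr : prime p by move: p_n; rewrite mem_primes => /andP[].
rewrite mulnC expnM leq_exp2r ?logn_gt0 // subn1.
by rewrite -{1}(prednK (prime_gt0 p_pr)) ltn_expl.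
Qed.

(** * Extension of characters *)

Section PartialCharacters.
Variable A : zmodType.
Implicit Types (K : A -> Prop) (chi : A -> algC).

(** A character of the subgroup [K] with values in the roots of unity. The domain
    is explicit because characters are extended one element at a time. *)
Record partial_char K chi : Prop := PartialChar {
  pchar_dom0 : K 0;
  pchar_domB : forall x y, K x -> K y -> K (x - y);
  pcharD : forall x y, K x -> K y -> chi (x + y) = chi x * chi y;
  pchar_unity : forall x, K x -> finite_order (chi x)
}.

Definition extends_pchar K chi K' chi' :=
  forall x, K x -> K' x /\ chi' x = chi x.

Section Theory.
Variables (K : A -> Prop) (chi : A -> algC).
Hypothesis chiP : partial_char K chi.

Lemma pchar_domN x : K x -> K (- x).
Proof. by rewrite -sub0r; apply: pchar_domB chiP _ _ (pchar_dom0 chiP). Qed.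

Lemma pchar_domD x y : K x -> K y -> K (x + y).
Proof.
by move=> Kx /pchar_domN Ky; rewrite -[y]opprK; apply: pchar_domB chiP _ _ Kx Ky.
Qed.

Lemma pchar_domMn x n : K x -> K (x *+ n).
Proof.
move=> Kx; elim: n => [|n IHn]; first exact: pchar_dom0 chiP.
by rewrite mulrS; apply: pchar_domD.
Qed.

Lemma pchar_domMz x (n : int) : K x -> K (x *~ n).
Proof.
by move=> Kx; case: n => n; [|apply: pchar_domN]; apply: pchar_domMn.
Qed.

Lemma pchar_neq0 x : K x -> chi x != 0.
Proof. by move/(pchar_unity chiP)/finite_order_neq0. Qed.

Lemma pchar0 : chi 0 = 1.
Proof.
have K0 := pchar_dom0 chiP; apply: (mulIf (pchar_neq0 K0)).
by rewrite -(pcharD chiP) // mul1r addr0.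
Qed.

Lemma pcharMn x n : K x -> chi (x *+ n) = chi x ^+ n.
Proof.
move=> Kx; elim: n => [|n IHn]; first exact: pchar0.
by rewrite mulrS exprS (pcharD chiP) ?IHn //; apply: pchar_domMn.
Qed.

Lemma pcharMz x (n : int) : K x -> chi (x *~ n) = chi x ^ n.
Proof.
move=> Kx; case: n => n; first exact: pcharMn.
have Kn := pchar_domMn n.+1 Kx; have Kn' := pchar_domN Kn.
rewrite -[_ *~ _]/(- (x *+ n.+1)) -[_ ^ _]/(chi x ^- n.+1) -pcharMn //.
apply: (mulIf (pchar_neq0 Kn)).
by rewrite -(pcharD chiP) // addNr pchar0 mulVf ?pchar_neq0.
Qed.

Lemma pchar_sum (I : Type) (r : seq I) (F : I -> A) :
  (forall i, K (F i)) ->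
  K (\sum_(i <- r) F i) /\ chi (\sum_(i <- r) F i) = \prod_(i <- r) chi (F i).
Proof.
move=> KF; elim/big_rec2: _ => [|i x y _ [Ky <-]].
  by split; [apply: pchar_dom0 chiP | apply: pchar0].
by rewrite (pcharD chiP) //; split=> //; apply: pchar_domD.
Qed.

(** A character extends to the subgroup generated by its domain and [e], with
    value [w] at [e], as soon as [w] is compatible with the multiples of [e] that
    already lie in the domain: the value at [x] is [chi (x - e *~ n) * w ^ n], for
    any [n] with [x - e *~ n] in the domain. *)
Lemma pchar_adjoin e w :
  finite_order w -> (forall n : int, K (e *~ n) -> chi (e *~ n) = w ^ n) ->
  exists K' chi', [/\ partial_char K' chi', extends_pchar K chi K' chi',
                      K' e & chi' e = w].
Proof.
move=> wU ew; have w0 := finite_order_neq0 wU.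
pose D x := [set n : int | K (x - e *~ n)]%classic.
pose K' x := exists n, D x n.
pose val x n := chi (x - e *~ n) * w ^ n.
pose chi' x := val x (xget 0 (D x)).
have valE x m n : D x m -> D x n -> val x m = val x n.
  move=> Dm Dn; rewrite /val.
  have -> : x - e *~ m = (x - e *~ n) + e *~ (n - m).
    by rewrite mulrzBr addrA subrK.
  have Knm : K (e *~ (n - m)).
    have := pchar_domB chiP Dm Dn.
    by rewrite opprB addrC addrA subrK -mulrzBr.
  by rewrite (pcharD chiP) // ew // -mulrA -expfzDr // subrK.
have chi'E x n : D x n -> chi' x = val x n.
  by move=> Dn; apply: valE (Dn); apply: xgetPex; exists n.
have DB x y m n : D x m -> D y n -> D (x - y) (m - n).
  move=> Dm Dn; rewrite /D /=.
  have -> : x - y - e *~ (m - n) = (x - e *~ m) - (y - e *~ n).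
    by rewrite mulrzBr !opprB addrACA [RHS]addrACA [- y + _]addrC.
  exact: pchar_domB chiP _ _ Dm Dn.
have DD x y m n : x + y - e *~ (m + n) = (x - e *~ m) + (y - e *~ n).
  by rewrite mulrzDr opprD addrACA.
have D0 x : K x -> D x 0 by rewrite /D /= mulr0z subr0.
have De : D e 1 by rewrite /D /= mulr1z subrr; apply: pchar_dom0 chiP.
exists K', chi'; split.
- split.
  + by exists 0; apply: D0; apply: pchar_dom0 chiP.
  + by move=> x y [m Dm] [n Dn]; exists (m - n); apply: DB.
  + move=> x y [m Dm] [n Dn].
    have Dmn : D (x + y) (m + n).
      by rewrite /D /= DD; apply: pchar_domD.
    rewrite (chi'E _ _ Dmn) (chi'E _ _ Dm) (chi'E _ _ Dn) /val DD.
    by rewrite (pcharD chiP) // expfzDr // mulrACA.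
  + move=> x [m Dm]; rewrite (chi'E _ _ Dm); apply: finite_orderM.
      exact: pchar_unity chiP _ Dm.
    exact: finite_orderXz.
- move=> x /D0 Dx; split; first by exists 0.
  by rewrite (chi'E _ _ Dx) /val mulr0z subr0 expr0z mulr1.
- by exists 1.
- by rewrite (chi'E _ _ De) /val mulr1z subrr pchar0 mul1r expr1z.
Qed.

(** The multiples of [e] in the domain form an ideal of the integers, either null
    or generated by its least positive element. *)
Lemma pchar_dom_period e :
  (forall n : int, K (e *~ n) -> n = 0) \/
  exists2 d, (0 < d)%N & K (e *+ d) /\
    forall n : int, K (e *~ n) -> exists q : int, n = d%:Z * q.
Proof.
have [ex_d|no_d] := pselect (exists d, (0 < d)%N && `[< K (e *+ d) >]).
  right; case: (ex_minnP ex_d) => d /andP[d0 /asboolP Kd] d_min.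
  exists d => //; split=> // n Kn; exists (n %/ d)%Z.
  have dn := divz_eq n d.
  suff /eqP r0 : (n %% d)%Z == 0 by rewrite {1}dn r0 addr0 mulrC.
  have d0' : d%:Z != 0 by rewrite lt0r_neq0 // ltz_nat.
  have := modz_ge0 n d0'; have := ltz_pmod n (d0 : 0 < d%:Z).
  have Kr : K (e *~ (n %% d)%Z).
    have -> : (n %% d)%Z = n - d%:Z * (n %/ d)%Z.
      by rewrite {2}dn mulrC addrC addKr.
    rewrite mulrzBr mulrzA; apply: pchar_domB chiP _ _ Kn _.
    exact: pchar_domMz.
  case: (n %% d)%Z Kr => // -[//|r] Kr rd _.
  rewrite ltz_nat in rd.
  by have := d_min r.+1; rewrite [(d <= _)%N]leqNgt rd => /(_ (asboolT Kr)).
left=> n Kn; apply/eqP; apply: contra_notT no_d => n0.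
exists `|n|%N; rewrite absz_gt0 n0; apply/asboolP.
by case: n Kn {n0} => n // /pchar_domN; rewrite opprK.
Qed.

(** A compatible value exists because roots of unity have roots of all orders. *)
Lemma pchar_adjoin_elt e :
  exists K' chi', [/\ partial_char K' chi', extends_pchar K chi K' chi' & K' e].
Proof.
suff [w wU ew] : exists2 w, finite_order w &
    forall n : int, K (e *~ n) -> chi (e *~ n) = w ^ n.
  by have [K' [chi' [? ? ? _]]] := pchar_adjoin wU ew; exists K', chi'.
have [e_free|[d d0 [Kd e_per]]] := pchar_dom_period e.
  exists 1; first exact: finite_order1.
  by move=> n /e_free ->; rewrite mulr0z pchar0 exp1rz.
have [c c0 zc] := pchar_unity chiP Kd.
pose w := d.-root (chi (e *+ d)).
have wd : w ^+ d = chi (e *+ d) by apply: rootCK.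
have wU : finite_order w.
  by exists (d * c)%N; rewrite ?muln_gt0 ?d0 // exprM wd.
exists w => // n /[dup] Kn /e_per[q def_n]; rewrite def_n in Kn *.
by rewrite -exprz_exp -exprnP wd mulrzA; apply: pcharMz.
Qed.

End Theory.

Lemma pchar_adjoin_seq K chi (s : seq A) :
  partial_char K chi ->
  exists K' chi', [/\ partial_char K' chi', extends_pchar K chi K' chi' &
                      forall e, e \in s -> K' e].
Proof.
move=> chiP; elim: s => [|e s [K1 [chi1 [chi1P ext1 sK1]]]].
  by exists K, chi; split.
have [K2 [chi2 [chi2P ext2 K2e]]] := pchar_adjoin_elt chi1P e.
exists K2, chi2; split=> // [x /ext1[K1x <-]|f]; first exact: ext2.
by rewrite inE => /predU1P[->|/sK1/ext2[]].
Qed.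

(** The trivial character of [H] extends to the subgroup generated by [H] and [b]
    with a nontrivial value at [b]: a primitive [d]-th root of unity when the
    class of [b] modulo [H] has order [d], and [-1] when that order is infinite. *)
Lemma pchar_separates (H : zmodClosed A) b : b \notin H ->
  exists K chi, [/\ partial_char K chi, {in H, forall x, K x /\ chi x = 1},
                   K b & chi b != 1].
Proof.
move=> Hb; pose K x := is_true (x \in H).
have oneP : partial_char K (fun=> 1).
  split=> [|x y Kx Ky|x y _ _|x _]; rewrite ?mulr1 //; first exact: rpred0.
    exact: rpredB.
  exact: finite_order1.
suff [w [wU w1 wb]] : exists w, [/\ finite_order w, w != 1 &
    forall n : int, K (b *~ n) -> 1 = w ^ n].
  have [K' [chi' [chi'P ext Kb chib]]] := pchar_adjoin oneP wU wb.
  by exists K', chi'; rewrite chib; split=> // x /ext.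
have [b_free|[d d0 [Kd b_per]]] := pchar_dom_period oneP b.
  exists (-1); split=> [||n /b_free ->]; rewrite ?expr0z //.
    by exists 2%N; rewrite ?sqrrN ?expr1n.
  by rewrite eqNr oner_eq0.
have [w wP] := C_prim_root_exists d0.
exists w; split=> [||n /b_per[q ->]].
- by exists d; rewrite ?(prim_expr_order wP).
- apply: contraNneq Hb => w1; rewrite -[b]mulr1n.
  rewrite [1%N](_ : _ = d) //; apply/esym/eqP.
  by rewrite -dvdn1 (prim_order_dvd wP) expr1 w1.
- by rewrite -exprz_exp -exprnP (prim_expr_order wP) exp1rz.
Qed.

(** The form in which characters are used. On the subgroup generated by the
    [e i], a character trivial on [H] is an exponential function of the
    coordinates; it is constant, of value [z != 1], on the coset [b + H]. *)
Lemma separating_exponentials (H : zmodClosed A) b r (e : 'I_r -> A) :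
  b \notin H ->
  exists (w : 'I_r -> algC) (z : algC),
    [/\ forall i, finite_order (w i), finite_order z, z != 1 &
       forall x : 'I_r -> nat, \sum_i e i *+ x i - b \in H ->
         \prod_i w i ^+ x i = z].
Proof.
move=> /pchar_separates[K0 [chi0 [chi0P H1 K0b b1]]].
have [K [chi [chiP ext Ke]]] := pchar_adjoin_seq (codom e) chi0P.
have {}Ke i : K (e i) by apply/Ke/codom_f.
have [Kb chib] := ext _ K0b.
exists (fun i => chi (e i)), (chi b); split=> [i|||x xH].
- exact: pchar_unity chiP _ (Ke i).
- exact: pchar_unity chiP _ Kb.
- by rewrite chib.
have [K0x chi0x] := H1 _ xH; have [Kx chix] := ext _ K0x.
have [_ chi_sum] :=
  pchar_sum chiP (index_enum _) (fun i => pchar_domMn chiP (x i) (Ke i)).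
under eq_bigr do rewrite -(pcharMn chiP) //.
by rewrite -chi_sum -(subrK b (\sum_i _)) (pcharD chiP) // chix chi0x mul1r.
Qed.
End PartialCharacters.

(** * Orthogonality and divisibility by the index *)

(** Translating by some [y] with [psi y != 1] multiplies the sum by [psi y]. *)
Lemma sum_char_subgroup (G : finZmodType) (S : {set G}) (psi : G -> algC) :
  (forall x y, y \in S -> (x + y \in S) = (x \in S)) ->
  {morph psi : x y / x + y >-> x * y} ->
  \sum_(x in S) psi x = if [forall x in S, psi x == 1] then #|S|%:R else 0.
Proof.
move=> SD psiD; case: ifPn => [/forall_inP psi1|].
  rewrite (eq_bigr (fun=> 1)) => [|x /psi1/eqP //].
  by rewrite sumr_const.
rewrite negb_forall_in => /exists_inP[y Sy psi_y].
apply/eqP; have /negPf psi_y' : psi y - 1 != 0 by rewrite subr_eq0.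
rewrite -(orFb (_ == 0)) -psi_y' -mulf_eq0 mulrBl mul1r subr_eq0 mulr_sumr.
rewrite [eqbRHS](reindex_inj (addIr y)) /=; apply/eqP/eq_big => x.
  by rewrite SD.
by rewrite psiD mulrC.
Qed.

Lemma card_additive_image (G : finZmodType) (B : zmodType) (phi : G -> B) :
  {morph phi : x y / x + y} ->
  #|G| = (size (undup (codom phi)) * #|[set x | phi x == 0%R]|)%N.
Proof.
move=> phiD; set u := undup _; set H := [set x | _].
have fibre q : q \in u -> (\sum_x (phi x == q) = #|H|)%N.
  rewrite mem_undup => /codomP[y ->]; rewrite -(card_imset (mem H) (addIr y)).
  rewrite -sum1_card big_mkcond [RHS]big_mkcond; apply: eq_bigr => x _ /=.
  rewrite -{1}[x](subrK y) phiD -{2}[phi y]add0r (inj_eq (addIr _)).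
  suff -> : (x \in [set z + y | z in H]) = (phi (x - y) == 0) by case: (_ == _).
  by rewrite -{1}[x](subrK y) (mem_imset _ _ (addIr y)) inE.
have -> : (size u * #|H| = \sum_(q <- u) #|H|)%N.
  by rewrite big_const_seq count_predT iter_addn_0 mulnC.
rewrite (eq_big_seq (fun q => \sum_x (phi x == q))%N) => [|q /fibre //].
rewrite exchange_big -sum1_card /=; apply: eq_bigr => x _.
have x_u : phi x \in u by rewrite mem_undup codom_f.
have := count_uniq_mem (phi x) (undup_uniq (codom phi)).
rewrite x_u -sum1_count big_mkcond /= => <-; apply: eq_bigr => q _.
by rewrite eq_sym; case: (_ == _).
Qed.

(** Let [h] be the combination of the characters [psi i] with coefficients [c i],
    supported on the kernel [H] of [phi]. Its sum against the inverse of [psi k]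
    is the same over [H] and over [G]. By orthogonality, the sum over [H] is
    [#|H|] times the sum of the [c i] such that [psi i] and [psi k] agree on [H],
    and the sum over [G] is [#|G|] times a similar sum. Hence the index of [H],
    which is the number of values of [phi], divides the sum of the [c i] over
    each class of characters that agree on [H]. *)
Lemma dvdA_sum_characters (G : finZmodType) (B : zmodType) (phi : G -> B)
    (I : finType) (psi : I -> G -> algC) (c : I -> algC) :
  {morph phi : x y / x + y} ->
  (forall i, {morph psi i : x y / x + y >-> x * y}) ->
  (forall i x, psi i x != 0) ->
  (forall i, c i \in Aint) ->
  (forall x, phi x != 0 -> \sum_i c i * psi i x = 0) ->
  ((size (undup (codom phi)))%:R %| \sum_i c i)%A.
Proof.
move=> phiD psiD psi0 cA h0; set n := size _; pose H := [set x | phi x == 0].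
have HD x y : y \in H -> (x + y \in H) = (x \in H).
  by rewrite !inE phiD => /eqP ->; rewrite addr0.
pose agree (S : {set G}) i k := [forall x in S, psi i x == psi k x].
(* Orthogonality, used below for [S = H] and for [S = G]. *)
have sum_agree (S : {set G}) k :
    (forall x y, y \in S -> (x + y \in S) = (x \in S)) ->
    \sum_(x in S) (\sum_i c i * psi i x) / psi k x =
    #|S|%:R * \sum_(i | agree S i k) c i.
  move=> SD; under eq_bigr do rewrite mulr_suml.
  rewrite exchange_big mulr_sumr [RHS]big_mkcond /=; apply: eq_bigr => i _.
  under eq_bigr do rewrite -mulrA; rewrite -mulr_sumr.
  rewrite (sum_char_subgroup SD) => [|x y]; last by rewrite !psiD invfM mulrACA.
  have -> : [forall x in S, psi i x / psi k x == 1] = agree S i k.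
    apply: eq_forallb_in => x _.
    by rewrite -(inj_eq (mulIf (psi0 k x))) mul1r divfK.
  by case: ifP => _; rewrite ?mulr0 // mulrC.
have class_sum k : \sum_(i | agree H i k) c i =
    n%:R * \sum_(i | agree [set: G]%SET i k) c i.
  have H0 : #|H|%:R != 0 :> algC.
    rewrite pnatr_eq0 -lt0n; apply/card_gt0P; exists 0.
    by rewrite inE -(inj_eq (addrI (phi 0))) -phiD !addr0.
  apply: (mulfI H0); rewrite -sum_agree //.
  rewrite mulrA -natrM mulnC -card_additive_image // -cardsT -sum_agree; last first.
    by move=> x y _; rewrite !inE.
  rewrite [RHS](bigID (mem H)) /= [X in _ = _ + X]big1 ?addr0 => [|x]; last first.
    by rewrite !inE => /h0 ->; rewrite mul0r.
  by apply: eq_bigl => x; rewrite finset.in_setT.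
have agree_refl i : agree H i i by apply/forall_inP.
(* A canonical representative of each class of characters that agree on [H]. *)
pose rep i := odflt i [pick k | agree H i k].
have repP i : agree H i (rep i).
  by rewrite /rep; case: pickP => [k //|/(_ i)]; rewrite agree_refl.
have agreeE i k : agree H i k -> agree H i =1 agree H k.
  move=> /forall_inP ik l.
  by apply: eq_forallb_in => x Hx; rewrite (eqP (ik x Hx)).
have rep_eq i k : agree H i k -> rep i = rep k.
  move=> ik; rewrite /rep (eq_pick (agreeE _ _ ik)).
  by case: pickP => // /(_ k); rewrite agree_refl.
have rep_class k : exists2 y, y \in Aint & \sum_(i | rep i == k) c i = n%:R * y.
  have [/existsP[i0 /eqP def_k]|no_k] := boolP [exists i, rep i == k].
    exists (\sum_(i | agree [set: G]%SET i k) c i); first exact: rpred_sum.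
    rewrite -class_sum; apply: eq_bigl => i; apply/eqP/idP => [<- //|/rep_eq ->].
    by rewrite -def_k -(rep_eq _ _ (repP i0)).
  exists 0; rewrite ?Aint0 // mulr0 big_pred0 // => i.
  by apply: contraNF no_k => ik; apply/existsP; exists i.
have {}/fin_all_exists2[y yA yE] := rep_class.
apply/dvdAP; exists (\sum_k y k); first exact: rpred_sum.
rewrite (partition_big rep predT) //= mulr_sumr.
by apply: eq_bigr.
Qed.

(** * Covers of the complement of a subgroup *)

(** The exponent is taken greater than [1] so that the residue of [1] is nonzero. *)
Lemma finite_order_common_exponent (T : finType) (f : T -> algC) :
  (forall t, finite_order (f t)) ->
  exists2 N, (1 < N)%N & forall t, f t ^+ N = 1.
Proof.
move=> /fin_all_exists2[d d0 fd]; exists (2 * \prod_t d t)%N.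
  by rewrite (@leq_pmulr 2) // prodn_gt0.
by move=> t; rewrite (bigD1 t) //= mulnCA exprM fd expr1n.
Qed.

Lemma sum_subset_prod (J : finType) (f z : J -> algC) :
  \sum_(S : {set J}) (\prod_j (if j \in S then 1 else - z j)) *
                     (\prod_j (if j \in S then f j else 1)) =
  \prod_j (f j - z j).
Proof.
rewrite bigA_distr; apply: eq_bigr => S _; rewrite -big_split /=.
by apply: eq_bigr => j _; case: ifP; rewrite ?mul1r ?mulr1.
Qed.

(** Each coset [b j + K j] is contained in a level set [chi j = z j != 1] of a
    character, so [h x = \prod_j (chi j x - z j)] vanishes wherever [pi] does
    not. On the subgroup generated by the [e i] the characters have a common
    finite exponent [N], and so does the image under [pi]: a value of [pi] at a
    multiple of [N] is null because all the [chi j] equal [1] there. Everything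
    thus lives on the finite group of coordinates modulo [N]. Expanding the
    product makes [h] a combination of characters with coefficients in the
    algebraic integers, so the size of the image divides [h 0], the product of
    the [1 - z j]. *)
Lemma mycielski_bound (A B : zmodType) (pi : {additive A -> B}) (J : finType)
    (K : J -> zmodClosed A) (b : J -> A) r (e : 'I_r -> A) :
  (forall j, b j \notin K j) ->
  (forall x, pi x != 0 -> exists j, x - b j \in K j) ->
  exists u : seq B, [/\ uniq u, forall i, pi (e i) \in u &
                        (mycielski (size u) <= #|J|)%N].
Proof.
move=> Kb cover.
have /fin_all_exists[w /fin_all_exists[z wzP]] j :=
  separating_exponentials e (Kb j).
have wU j i : finite_order (w j i) by case: (wzP j).
have zU j : finite_order (z j) by case: (wzP j).
have z1 j : z j != 1 by case: (wzP j).
have wz (x : 'I_r -> nat) : \sum_i pi (e i) *+ x i != 0 ->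
    exists j, \prod_i w j i ^+ x i = z j.
  have -> : \sum_i pi (e i) *+ x i = pi (\sum_i e i *+ x i).
    by rewrite raddf_sum; apply: eq_bigr => i _; rewrite raddfMn.
  by move=> /cover[j xj]; exists j; case: (wzP j) => _ _ _; apply.
have [[|[|N]] // _ wN] :=
  finite_order_common_exponent (fun ji : J * 'I_r => wU ji.1 ji.2).
(* A nonzero value would put [e i *+ N.+2] in a coset, giving [1 = z j]. *)
have piN i : pi (e i) *+ N.+2 = 0.
  have sumE : \sum_k pi (e k) *+ (N.+2 * (k == i)) = pi (e i) *+ N.+2.
    rewrite (bigD1 i) //= eqxx muln1 big1 ?addr0 // => k /negPf ->.
    by rewrite muln0.
  rewrite -sumE; apply/eqP/negPn/negP => /wz[j].
  rewrite big1 => [zj|k _]; first by have := z1 j; rewrite -zj eqxx.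
  by rewrite exprM (wN (j, k)) expr1n.
pose G : finZmodType := 'rV['I_N.+2]_r.
pose phi (x : G) := \sum_i pi (e i) *+ x 0 i.
pose chi j (x : G) := \prod_i w j i ^+ x 0 i.
have phiD : {morph phi : x y / x + y}.
  move=> x y; rewrite -big_split; apply: eq_bigr => i _; rewrite mxE /=.
  rewrite -mulrnDr [in RHS](divn_eq (x 0 i + y 0 i) N.+2).
  by rewrite [in RHS]mulrnDr mulnC mulrnA piN mul0rn add0r.
have chiD j : {morph chi j : x y / x + y >-> x * y}.
  move=> x y; rewrite -big_split; apply: eq_bigr => i _; rewrite mxE /=.
  by rewrite expr_mod ?exprD // (wN (j, i)).
pose psi (S : {set J}) x := \prod_j (if j \in S then chi j x else 1).
pose c (S : {set J}) := \prod_j (if j \in S then 1 else - z j).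
have sum_psi x : \sum_S c S * psi S x = \prod_j (chi j x - z j).
  exact: sum_subset_prod.
have rootA y : finite_order y -> y \in Aint.
  by case=> d d0 yd; apply: (@Aint_unity_root d); rewrite // unity_rootE yd.
exists (undup (codom phi)); split; first exact: undup_uniq.
  move=> i; rewrite mem_undup; apply/codomP.
  (* The [i]-th unit vector is mapped to [pi (e i)]. *)
  exists (\row_k if k == i then 1 else 0); rewrite /phi (bigD1 i) //= mxE eqxx.
  by rewrite big1 ?addr0 // => k /negPf ki; rewrite mxE ki.
apply: (@mycielski_le_card _ z _ z1 zU).
have chi0 j : chi j 0 = 1.
  by rewrite /chi big1 // => i _; rewrite mxE.
have <- : \sum_S c S = \prod_j (1 - z j).
  under [RHS]eq_bigr => j do rewrite -(chi0 j).
  rewrite -sum_psi; apply: eq_bigr => S _.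
  by rewrite /psi big1 ?mulr1 // => j _; rewrite chi0 if_same.
apply: (dvdA_sum_characters phiD (psi := psi)).
- move=> S x y; rewrite -big_split; apply: eq_bigr => j _ /=.
  by case: ifP; rewrite ?chiD ?mulr1.
- move=> S x; apply/prodf_neq0 => j _; case: ifP => _; rewrite ?oner_eq0 //.
  by apply/prodf_neq0 => i _; rewrite expf_neq0 // finite_order_neq0.
- move=> S; apply: rpred_prod => j _; case: ifP => _; first exact: rpred1.
  by rewrite rpredN rootA.
- move=> x /wz[j chi_j]; rewrite sum_psi; apply/eqP/prodf_eq0.
  by exists j; rewrite // subr_eq0; apply/eqP.
Qed.

(** * Irredundant cosets of an m-cover *)

Lemma pi_ringQuot_neq0 (R : pzRingType) (I : twoSidedIdeal R) (x : R) :
  (\pi_(ringQuot I)%qT x != 0) = (x \notin I).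
Proof.
by rewrite -(raddf0 \pi_(ringQuot I)%qT) -Quotient.idealrBE subr0.
Qed.

(** At a point [x0] witnessing irredundancy, at most [m - 1] of the cosets other
    than the [t]-th contain [x0], and the [t]-th does. Take for [P] the cosets
    that miss [x0], at most [k - m] in number. If [y] is not in [I t] then
    [x0 + y] is not in the [t]-th coset; being in at least [m] cosets, it lies in
    one that misses [x0]. *)
Lemma irredundant_reduction (m k : nat) (R : pzRingType) (a : 'I_k -> R)
    (I : 'I_k -> twoSidedIdeal R) (t : 'I_k) :
  is_mcover m a I [set: 'I_k]%SET -> irredundant m a I t ->
  exists x0 (P : pred 'I_k),
    [/\ (m + #|P| <= k)%N,
        forall s, P s -> a s - x0 \notin I s &
        forall y, y \notin I t -> exists2 s, P s & y - (a s - x0) \in I s].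
Proof.
move=> cover /existsNP[x0 /negP]; rewrite -ltnNge => uncovered.
pose C x := [set s | x \in icoset (a s) (I s)]%SET.
have C_ge x : (m <= #|C x|)%N.
  apply: leq_trans (cover x) (subset_leq_card _).
  by apply/fintype.subsetP => s; rewrite !inE.
have uncovered' : (#|C x0 :\ t| < m)%N.
  by congr (_ < _)%N: uncovered; apply: eq_card => s; rewrite !inE.
have t_x0 : t \in C x0.
  move: (leq_trans uncovered' (C_ge x0)); rewrite (cardsD1 t (C x0)).
  by case: (t \in _); rewrite ?ltnn.
exists x0, [pred s | s \notin C x0]; split.
- rewrite -[leqRHS]card_ord -(cardC [in C x0]) leq_add ?C_ge //.
- by move=> s /=; rewrite !inE -opprB rpredN.
- move=> y yI; have [s] : exists s, s \in C (x0 + y) :\: (C x0 :\ t).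
    apply/finset.set0Pn; apply: contraTneq (C_ge (x0 + y)) => /eqP.
    rewrite finset.setD_eq0 => /subset_leq_card/leq_ltn_trans/(_ uncovered').
    by rewrite ltnNge.
  rewrite !inE negb_and negbK => /andP[/orP[/eqP ->|sC] sy].
    case/negP: yI; move: t_x0 sy; rewrite !inE => tx0 txy.
    have <- : x0 + y - a t - (x0 - a t) = y.
      by rewrite opprB subrKA addrAC subrr add0r.
    exact: rpredB.
  by exists s; rewrite /= ?inE // opprB addrA [y + x0]addrC.
Qed.

Theorem corollary1p2 (m k : nat) (hm : (0 < m)%N) (hk : (0 < k)%N)
    (R : pzRingType) (a : 'I_k -> R) (I : 'I_k -> twoSidedIdeal R) (t : 'I_k)
    (hcover : is_mcover m a I [set: 'I_k]%SET)
    (hirr : irredundant m a I t) :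
  finite_set [set: ringQuot (I t)]%classic /\
  (#|` fset_set [set: ringQuot (I t)]%classic | <= 2 ^ (k - m))%N /\
  (m + mycielski #|` fset_set [set: ringQuot (I t)]%classic | <= k)%N.
Proof.
have [x0 [P [mPk aI coverP]]] := irredundant_reduction hcover hirr.
have m_le_k : (m <= k)%N := leq_trans (leq_addr _ _) mPk.
(* Every finite set of residues lies in a set, in fact a subgroup, whose size
   obeys the bound; this gives finiteness as well as the bound itself. *)
have small (s : seq (ringQuot (I t))) : exists u : seq (ringQuot (I t)),
    [/\ uniq u, {subset s <= u} & (m + mycielski (size u) <= k)%N].
  pose e (i : 'I_(size s)) : R := repr (tnth (in_tuple s) i).
  pose K (j : {s | P s}) : zmodClosed R := I (val j).
  have [|y|u [u_uniq eu u_le]] := @mycielski_bound R (ringQuot (I t))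
    \pi_(ringQuot (I t))%qT {s | P s} K (fun j => a (val j) - x0) _ e.
  - by move=> j; apply: aI (valP j).
  - by rewrite pi_ringQuot_neq0 => /coverP[i Pi yi]; exists (Sub i Pi).
  exists u; split=> // [q qs|].
    have /tnthP[i ->] : q \in in_tuple s by [].
    by rewrite -[tnth _ _](@reprK _ (ringQuot (I t))); apply: eu.
  by apply: leq_trans mPk; rewrite leq_add2l (leq_trans u_le) // card_sig.
have small_le u : (m + mycielski u <= k)%N -> (u <= 2 ^ (k - m))%N.
  move=> u_le; apply: leq_trans (leq_exp2_mycielski u) _.
  by rewrite leq_exp2l // leq_subRL.
have fin : finite_set [set: ringQuot (I t)]%classic.
  apply: contrapT => /(infinite_set_fset (2 ^ (k - m)).+1)[S _].
  have [u [u_uniq Su /small_le u_le]] := small S.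
  by rewrite ltnNge (leq_trans (uniq_leq_size (fset_uniq S) Su)).
have [u [u_uniq Su u_le]] := small (fset_set [set: ringQuot (I t)]%classic).
have -> : #|` fset_set [set: ringQuot (I t)]%classic| = size u.
  apply/perm_size/uniq_perm => // q; apply/idP/idP => [/Su //|_].
  by rewrite in_fset_set // inE.
by split=> //; split=> //; apply: small_le.
Qed.
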